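(* Let $n\ge 2$ and let $\Gamma$ be a directed cycle of order $n$. Then the Laplacian spread of $\Gamma$ satisfies \[ \operatorname{sp}(\Gamma)=\begin{cases}1+\cos\left(\frac{2\pi}{n}\right) & \text{if } n \text{ is even},\\[2pt] \cos\left(\frac{2\pi}{n}\right)-\cos\left(\pi\frac{n-1}{n}\right) & \text{if } n \text{ is odd}.\end{cases} \]
   Context: A simple digraph $\Gamma=(V,E)$ of order $n$ has vertex set $V=\{1,\dots,n\}$ and edge set $E\subseteq V\times V$ with no loops and no multi-edges (both $(i,j)$ and $(j,i)$ may be edges). Its adjacency matrix is $A=[a_{ij}]$ with $a_{ij}=1$ if $(i,j)\in E$ and $a_{ij}=0$ otherwise, and its Laplacian matrix is $L=D-A$, where $D$ is the diagonal matrix whose $i$th diagonal entry is the out-degree $d^+(i)$ (the number of edges of the form $(i,j)\in E$). Let $\mathbf{e}$ be the all ones vector in $\mathbb{R}^n$. For $n\ge 2$ define \[ \alpha(\Gamma)=\min_{\mathbf{x}\in\mathbb{R}^n,\ \mathbf{x}\perp\mathbf{e},\ \|\mathbf{x}\|=1}\mathbf{x}^TL\mathbf{x},\qquad \beta(\Gamma)=\max_{\mathbf{x}\in\mathbb{R}^n,\ \mathbf{x}\perp\mathbf{e},\ \|\mathbf{x}\|=1}\mathbf{x}^TL\mathbf{x}, \] where $\|\cdot\|$ is the Euclidean norm. The Laplacian spread is $\operatorname{sp}(\Gamma)=\beta(\Gamma)-\alpha(\Gamma)$. (Equivalently, it is the length of the real part of the restricted numerical range $W_r(L)=\{\mathbf{x}^*L\mathbf{x}:\mathbf{x}\in\mathbb{C}^n,\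 \mathbf{x}\perp\mathbf{e},\ \|\mathbf{x}\|=1\}$.) A directed cycle (dicycle) of order $n$ is the digraph which, up to relabeling vertices, has edge set $\{(1,2),(2,3),\dots,(n-1,n),(n,1)\}$. *)

(* Defs.v *)
From mathcomp Require Import all_boot all_order all_algebra.
From mathcomp Require Import all_fingroup.
From mathcomp Require Import all_classical all_reals all_analysis.
From mathcomp Require Import lra.
Set Implicit Arguments.
Unset Strict Implicit.
Unset Printing Implicit Defensive.
Import Order.TTheory GRing.Theory Num.Theory.
Import numFieldNormedType.Exports.
Local Open Scope classical_set_scope.
Local Open Scope ring_scope.

Record digraph (n : nat) := Digraph {
  edge :> rel 'I_n;
  edge_irr : irreflexive edge }.

Definition out_degree n (G : digraph n) (i : 'I_n) : nat := #|[pred j | G i j]|.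

Definition adj_mx (R : realType) n (G : digraph n) : 'M[R]_n :=
  \matrix_(i, j) (G i j)%:R.

Definition outdeg_mx (R : realType) n (G : digraph n) : 'M[R]_n :=
  diag_mx (\row_i (out_degree G i)%:R).

Definition laplacian (R : realType) n (G : digraph n) : 'M[R]_n :=
  outdeg_mx R G - adj_mx R G.

Definition dotv (R : realType) n (x y : 'cV[R]_n) : R := (x^T *m y) 0 0.

(* Not `|x|, which on matrices is the sup norm. *)
Definition norm2 (R : realType) n (x : 'cV[R]_n) : R := Num.sqrt (dotv x x).

Definition restricted_sphere (R : realType) n : set 'cV[R]_n :=
  [set x | dotv x (const_mx 1) = 0 /\ norm2 x = 1].
Arguments restricted_sphere R n : clear implicits.

Definition quad_form (R : realType) n (M : 'M[R]_n) (x : 'cV[R]_n) : R :=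
  (x^T *m M *m x) 0 0.

Section attained.
Variables (R : realType) (n : nat).

Lemma dotvE (x y : 'cV[R]_n) : dotv x y = \sum_i x i 0 * y i 0.
Proof. by rewrite /dotv mxE; apply: eq_bigr => i _; rewrite mxE. Qed.

Lemma quad_formE (M : 'M[R]_n) (x : 'cV[R]_n) :
  quad_form M x = \sum_j (\sum_i x i 0 * M i j) * x j 0.
Proof.
rewrite /quad_form mxE; apply: eq_bigr => j _; rewrite mxE.
by congr (_ * _); apply: eq_bigr => i _; rewrite mxE.
Qed.

Lemma restricted_sphereE (x : 'cV[R]_n) :
  restricted_sphere R n x <-> \sum_i x i 0 = 0 /\ \sum_i x i 0 ^+ 2 = 1.
Proof.
have e1 : dotv x (const_mx 1) = \sum_i x i 0.
  by rewrite dotvE; apply: eq_bigr => i _; rewrite mxE mulr1.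
have e2 : dotv x x = \sum_i x i 0 ^+ 2.
  by rewrite dotvE; apply: eq_bigr => i _; rewrite expr2.
rewrite /restricted_sphere /= /norm2 e1 e2; split=> -[-> h]; split=> //.
  rewrite -[LHS]sqr_sqrtr ?h ?expr1n//.
  by apply: sumr_ge0 => i _; exact: sqr_ge0.
by rewrite h sqrtr1.
Qed.

Lemma restricted_sphere_nonempty : (2 <= n)%N -> restricted_sphere R n !=set0.
Proof.
move=> n2; pose i0 := Ordinal (ltnW n2); pose i1 := Ordinal n2.
pose c : R := (Num.sqrt 2)^-1.
have i10 : i1 != i0 by [].
exists (\col_i (if i == i0 then c else if i == i1 then - c else 0)).
have cE : c ^+ 2 = 2^-1 by rewrite /c exprVn sqr_sqrtr// ler0n.
apply/restricted_sphereE; split; rewrite (bigD1 i0)//= (bigD1 i1)//= big1.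
- by rewrite !mxE eqxx eqxx addr0 subrr.
- by move=> i /andP[/negPf h /negPf h']; rewrite mxE h h'.
- by rewrite !mxE eqxx eqxx addr0 sqrrN cE -[RHS]divr1; lra.
- by move=> i /andP[/negPf h /negPf h']; rewrite mxE h h' expr0n.
Qed.

Let S : set 'rV[R]_n := [set v | restricted_sphere R n v^T].

Let continuous_sum (f : 'I_n -> 'rV[R]_n -> R) :
  (forall i, continuous (f i)) -> continuous (fun v => \sum_i f i v).
Proof.
move=> cf v; rewrite (_ : (fun v => _) = \sum_i f i).
  apply: (big_ind (fun g : 'rV[R]_n -> R => {for v, continuous g})).
  - exact: cst_continuous.
  - by move=> g h cg ch; exact: continuousD.
  - by move=> i _; exact: cf.
by apply/funext => w; rewrite fct_sumE.
Qed.

Let continuous_coord i : continuous (fun v : 'rV[R]_n => v 0 i).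
Proof. exact: coord_continuous. Qed.

Let compactS : compact S.
Proof.
have SE : S = (fun v : 'rV[R]_n => \sum_i v 0 i) @^-1` [set 0] `&`
              (fun v : 'rV[R]_n => \sum_i v 0 i * v 0 i) @^-1` [set 1].
  have e1 (v : 'rV[R]_n) : \sum_i v^T i 0 = \sum_i v 0 i.
    by apply: eq_bigr => i _; rewrite mxE.
  have e2 (v : 'rV[R]_n) : \sum_i v^T i 0 ^+ 2 = \sum_i v 0 i * v 0 i.
    by apply: eq_bigr => i _; rewrite mxE expr2.
  by apply/funext => v; apply/propext; rewrite /S/= restricted_sphereE e1 e2.
have closedf (f : 'rV[R]_n -> R) y : continuous f -> closed (f @^-1` [set y]).
  by move=> /continuous_closedP; apply; exact: closed_eq.
have compactB := @rV_compact R n (fun=> `[-1, 1]%classic)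
  (fun=> @segment_compact R _ _).
apply: (subclosed_compact _ compactB).
  rewrite SE; apply: closedI; apply: closedf.
  - by apply: continuous_sum.
  - by apply: continuous_sum => i v; apply: continuousM; exact: continuous_coord.
move=> v; rewrite SE => -[_ /= v1] i; rewrite /= in_itv/= -ler_norml.
rewrite -(@ler_sqr _ _ 1) ?nnegrE// expr1n real_normK ?num_real// -v1.
rewrite (bigD1 i)//= expr2 lerDl; apply: sumr_ge0 => j _.
by rewrite -expr2 sqr_ge0.
Qed.

Let continuous_quad_form (M : 'M[R]_n) :
  continuous (fun v : 'rV[R]_n => quad_form M v^T).
Proof.
rewrite (_ : (fun v => _) =
  (fun v : 'rV[R]_n => \sum_j (\sum_i v 0 i * M i j) * v 0 j)); last first.
  apply/funext => v; rewrite quad_formE; apply: eq_bigr => j _; rewrite mxE.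
  by congr (_ * _); apply: eq_bigr => i _; rewrite mxE.
apply: continuous_sum => j v; apply: continuousM; last exact: continuous_coord.
apply: continuous_sum => i w; apply: continuousM; last exact: cst_continuous.
exact: continuous_coord.
Qed.

Let S_nonempty : (2 <= n)%N -> S !=set0.
Proof.
by move=> /restricted_sphere_nonempty[x Sx]; exists x^T; rewrite /S/= trmxK.
Qed.

Lemma quad_form_min (M : 'M[R]_n) : (2 <= n)%N ->
  exists2 x, restricted_sphere R n x &
    forall y, restricted_sphere R n y -> quad_form M x <= quad_form M y.
Proof.
move=> /S_nonempty S0; have [|v /set_mem Sv vmin] := EVT_min_rV S0 compactS
  (f := fun v => quad_form M v^T).
  by apply: continuous_subspaceT; exact: continuous_quad_form.
by exists v^T => // y Sy; rewrite -[y]trmxK; apply: vmin; rewrite inE /S/= trmxK.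
Qed.

Lemma quad_form_max (M : 'M[R]_n) : (2 <= n)%N ->
  exists2 x, restricted_sphere R n x &
    forall y, restricted_sphere R n y -> quad_form M y <= quad_form M x.
Proof.
move=> /S_nonempty S0; have [|v /set_mem Sv vmax] := EVT_max_rV S0 compactS
  (f := fun v => quad_form M v^T).
  by apply: continuous_subspaceT; exact: continuous_quad_form.
by exists v^T => // y Sy; rewrite -[y]trmxK; apply: vmax; rewrite inE /S/= trmxK.
Qed.

End attained.

(* For n >= 2 the infimum and the supremum below are attained, i.e. they are
   the minimum and the maximum: see alpha_min and beta_max. *)
Definition alpha (R : realType) n (G : digraph n) : R :=
  inf (quad_form (laplacian R G) @` restricted_sphere R n).

Definition beta (R : realType) n (G : digraph n) : R :=
  sup (quad_form (laplacian R G) @` restricted_sphere R n).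

Lemma alpha_min (R : realType) n (G : digraph n) : (2 <= n)%N ->
  (exists2 x, restricted_sphere R n x & quad_form (laplacian R G) x = alpha R G)
  /\ forall y, restricted_sphere R n y ->
       alpha R G <= quad_form (laplacian R G) y.
Proof.
move=> n2; have [x Sx xmin] := quad_form_min (laplacian R G) n2.
suff -> : alpha R G = quad_form (laplacian R G) x by split=> //; exists x.
have lb : lbound (quad_form (laplacian R G) @` restricted_sphere R n)
                 (quad_form (laplacian R G) x) by move=> _ [y Sy <-]; exact: xmin.
apply/eqP; rewrite eq_le; apply/andP; split.
  by apply: ge_inf; [exists (quad_form (laplacian R G) x) | exists x].
by apply: lb_le_inf => //; exists (quad_form (laplacian R G) x), x.
Qed.

Lemma beta_max (R : realType) n (G : digraph n) : (2 <= n)%N ->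
  (exists2 x, restricted_sphere R n x & quad_form (laplacian R G) x = beta R G)
  /\ forall y, restricted_sphere R n y ->
       quad_form (laplacian R G) y <= beta R G.
Proof.
move=> n2; have [x Sx xmax] := quad_form_max (laplacian R G) n2.
suff -> : beta R G = quad_form (laplacian R G) x by split=> //; exists x.
have ub : ubound (quad_form (laplacian R G) @` restricted_sphere R n)
                 (quad_form (laplacian R G) x) by move=> _ [y Sy <-]; exact: xmax.
apply/eqP; rewrite eq_le; apply/andP; split.
  by apply: ge_sup => //; exists (quad_form (laplacian R G) x), x.
by apply: ub_le_sup; [exists (quad_form (laplacian R G) x) | exists x].
Qed.

Definition laplacian_spread (R : realType) n (G : digraph n) : R :=
  beta R G - alpha R G.

(* ordS i is i + 1 modulo n; s is the relabeling of the vertices. *)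
Definition dicycle n (G : digraph n) : Prop :=
  exists s : {perm 'I_n}, forall i j : 'I_n, G (s i) (s j) = (j == ordS i).

(* Main.v *)
Require Import Defs.
From mathcomp Require Import all_boot all_order all_algebra.
From mathcomp Require Import all_fingroup.
From mathcomp Require Import all_classical all_reals all_analysis.
From mathcomp Require Import zify ring lra.
Import Order.TTheory GRing.Theory Num.Theory.
Local Open Scope ring_scope.

(** Relabelling the vertices, the quadratic form of the Laplacian at a unit
    vector x is 1 - sum_j x_j x_(j+1).  Let a_k + i b_k be the discrete Fourier
    coefficients of x.  By Parseval, n sum_j x_j^2 = sum_k (a_k^2 + b_k^2), and
    since the cyclic shift multiplies the k-th coefficient by exp(2 pi i k / n),
    n sum_j x_j x_(j+1) = sum_k cos(2 pi k / n) (a_k^2 + b_k^2).  When x is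
    orthogonal to the all ones vector the k = 0 terms vanish, so the form lies
    between the least and the greatest of 1 - cos(2 pi k / n) with 0 < k < n,
    which occur at k = 1 and k = n./2 respectively.  The vector
    (cos(2 pi k j / n))_j shows that each of these values is attained. *)

(** * Trigonometry of the n-th roots of unity *)

Section roots_of_unity.
Context {R : realType} (n : nat).

(* Real and imaginary parts of exp(2 pi i m / n). *)
Definition cosn (m : nat) : R := cos (2 * pi / n%:R * m%:R).
Definition sinn (m : nat) : R := sin (2 * pi / n%:R * m%:R).

Lemma cosnD a b : cosn (a + b) = cosn a * cosn b - sinn a * sinn b.
Proof. by rewrite /cosn natrD mulrDr cosD. Qed.

Lemma sinnD a b : sinn (a + b) = sinn a * cosn b + cosn a * sinn b.
Proof. by rewrite /sinn natrD mulrDr sinD. Qed.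

Lemma cosn2Dsinn2 a : cosn a ^+ 2 + sinn a ^+ 2 = 1.
Proof. exact: cos2Dsin2. Qed.

Lemma cosn0 : cosn 0 = 1.
Proof. by rewrite /cosn mulr0 cos0. Qed.

Hypothesis n0 : (0 < n)%N.

Let nE : n%:R != 0 :> R.
Proof. by rewrite pnatr_eq0 -lt0n. Qed.

Let angle_n : 2 * pi / n%:R * n%:R = pi *+ 2 :> R.
Proof. by rewrite mulfVK// mulr_natl. Qed.

Lemma cosnn : cosn n = 1.
Proof. by rewrite /cosn angle_n cos2pi. Qed.

Lemma sinnn : sinn n = 0.
Proof. by rewrite /sinn angle_n sin2pi. Qed.

Lemma cosnDn m : cosn (m + n) = cosn m.
Proof. by rewrite cosnD cosnn sinnn; ring. Qed.

Lemma sinnDn m : sinn (m + n) = sinn m.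
Proof. by rewrite sinnD cosnn sinnn; ring. Qed.

Lemma cosn_addM m q : cosn (m + q * n) = cosn m.
Proof. by elim: q => [|q IH]; rewrite ?addn0// mulSnr addnA cosnDn. Qed.

Lemma sinn_addM m q : sinn (m + q * n) = sinn m.
Proof. by elim: q => [|q IH]; rewrite ?addn0// mulSnr addnA sinnDn. Qed.

(** [ordS j] is j + 1 reduced modulo n; the multiple of n that is dropped, times k, changes the
    angle by a multiple of 2 pi. *)
Lemma cosn_ordS k (j : 'I_n) : cosn (k * ordS j) = cosn (k * j + k).
Proof.
by rewrite -mulnSr [in RHS](divn_eq j.+1 n) mulnDr mulnA addnC cosn_addM.
Qed.

Lemma sinn_ordS k (j : 'I_n) : sinn (k * ordS j) = sinn (k * j + k).
Proof.
by rewrite -mulnSr [in RHS](divn_eq j.+1 n) mulnDr mulnA addnC sinn_addM.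
Qed.

Lemma sum_ordS {V : nmodType} (f : 'I_n -> V) :
  \sum_j f (ordS j) = \sum_j f j.
Proof. by rewrite [RHS](reindex (@ordS n))//; apply/onW_bij/ordS_bij. Qed.

(* A sum over a full period is unchanged by the rotation through 2 pi m / n,
   so it is zero as soon as this rotation is not the identity. *)
Lemma sum_cosn_sinn m : (0 < m < n)%N ->
  \sum_(k < n) cosn (m * k) = 0 /\ \sum_(k < n) sinn (m * k) = 0.
Proof.
move=> /andP[m0 mn]; set A := \sum_k cosn _; set B := \sum_k sinn _.
have eA : A = A * cosn m - B * sinn m.
  rewrite {1}/A -sum_ordS 2!mulr_suml -sumrB.
  by apply: eq_bigr => j _; rewrite cosn_ordS cosnD.
have eB : B = B * cosn m + A * sinn m.
  rewrite {1}/B -sum_ordS 2!mulr_suml -big_split/=.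
  by apply: eq_bigr => j _; rewrite sinn_ordS sinnD.
have := cosn2Dsinn2 m => h.
(* Half-angle formula: cos(2t) = 1 - 2 sin(t)^2 with t = pi m / n strictly between 0 and pi, where
   the sine is positive. *)
have c1 : cosn m != 1.
  have th : pi * (m%:R / n%:R) *+ 2 = 2 * pi / n%:R * m%:R :> R.
    by rewrite -mulr_natl; ring.
  rewrite /cosn -th cos_mulr2n.
  have s0 : 0 < sin (pi * (m%:R / n%:R)) :> R.
    apply: sin_gt0_pi; rewrite mulr_gt0 ?pi_gt0 ?divr_gt0 ?ltr0n//=.
    by rewrite gtr_pMr ?pi_gt0// ltr_pdivrMr ?ltr0n// mul1r ltr_nat.
  have := cos2Dsin2 (pi * (m%:R / n%:R) : R).
  by apply: contra_eq_neq => /eqP; rewrite subr_eq => /eqP; nra.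
have d0 : 1 - cosn m != 0 by rewrite subr_eq0 eq_sym.
(* This is (1 - cosn m)^2 + (sinn m)^2, the determinant of the linear system [eA], [eB] in A and
   B. *)
have d1 : (1 - cosn m) * 2 != 0 by rewrite mulf_neq0.
by split; apply: (mulIf d1); rewrite mul0r; nra.
Qed.

Lemma sum_cosn_mul (j l : 'I_n) :
  \sum_(k < n) (cosn (k * j) * cosn (k * l) + sinn (k * j) * sinn (k * l))
  = n%:R * (j == l)%:R.
Proof.
(* Both sides are symmetric in j and l, and the order makes the truncated difference [j - l]
   exact. *)
wlog lj : j l / (l <= j)%N.
  move=> H; have [/H//|/ltnW /H h] := leqP l j.
  rewrite eq_sym -h; apply: eq_bigr => k _; ring.
have e (k : 'I_n) : cosn (k * j) * cosn (k * l) + sinn (k * j) * sinn (k * l) =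
    cosn ((j - l) * k).
  rewrite -{1 2}(subnK lj) mulnDr cosnD sinnD (mulnC k (j - l)%N).
  by rewrite -[RHS]mulr1 -(cosn2Dsinn2 (k * l)); ring.
rewrite (eq_bigr _ (fun k _ => e k)).
have [<-|jl] := eqVneq j l.
  under eq_bigr do rewrite subnn mul0n cosn0.
  by rewrite sumr_const card_ord mulr1.
rewrite mulr0; apply: (sum_cosn_sinn _ _).1.
rewrite subn_gt0 ltn_neqAle lj andbT eq_sym -(inj_eq val_inj) in jl *.
by rewrite jl (leq_ltn_trans (leq_subr _ _)).
Qed.

(** * Discrete Fourier transform, split into real and imaginary parts *)

Definition fcos (x : 'I_n -> R) (k : nat) := \sum_j x j * cosn (k * j).
Definition fsin (x : 'I_n -> R) (k : nat) := \sum_j x j * sinn (k * j).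

(** The bilinear form is needed to pair x with its cyclic shift. *)
Lemma parseval (x y : 'I_n -> R) :
  \sum_(k < n) (fcos x k * fcos y k + fsin x k * fsin y k)
  = n%:R * \sum_j x j * y j.
Proof.
transitivity (\sum_(k < n) \sum_j \sum_l x j * y l *
    (cosn (k * j) * cosn (k * l) + sinn (k * j) * sinn (k * l))).
  apply: eq_bigr => k _; rewrite /fcos /fsin !big_distrlr -big_split/=.
  apply: eq_bigr => j _; rewrite -big_split/=.
  by apply: eq_bigr => l _; ring.
rewrite exchange_big mulr_sumr /=; apply: eq_bigr => j _.
rewrite exchange_big /=; under eq_bigr do rewrite -mulr_sumr sum_cosn_mul.
rewrite (bigD1 j)//= big1 => [|l lj]; first by rewrite eqxx addr0 mulr1; ring.
by rewrite eq_sym (negPf lj) !mulr0.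
Qed.

(** With [fsin_ordS]: in this sign convention, the shift multiplies the k-th coefficient by exp(-2
    pi i k / n). *)
Lemma fcos_ordS x k :
  fcos (fun j => x (ordS j)) k = cosn k * fcos x k + sinn k * fsin x k.
Proof.
rewrite /fcos /fsin -(sum_ordS (fun j => x j * cosn (k * j))).
rewrite -(sum_ordS (fun j => x j * sinn (k * j))) !mulr_sumr -big_split/=.
apply: eq_bigr => j _; rewrite cosn_ordS sinn_ordS cosnD sinnD.
by rewrite -[LHS]mulr1 -(cosn2Dsinn2 k); ring.
Qed.

Lemma fsin_ordS x k :
  fsin (fun j => x (ordS j)) k = cosn k * fsin x k - sinn k * fcos x k.
Proof.
rewrite /fcos /fsin -(sum_ordS (fun j => x j * cosn (k * j))).
rewrite -(sum_ordS (fun j => x j * sinn (k * j))) !mulr_sumr -sumrB.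
apply: eq_bigr => j _; rewrite cosn_ordS sinn_ordS cosnD sinnD.
by rewrite -[LHS]mulr1 -(cosn2Dsinn2 k); ring.
Qed.

(** Pairing a coefficient with its rotated copy cancels the sine cross terms. *)
Lemma sum_shift (x : 'I_n -> R) :
  n%:R * \sum_j x j * x (ordS j)
  = \sum_(k < n) cosn k * (fcos x k ^+ 2 + fsin x k ^+ 2).
Proof.
rewrite -parseval; apply: eq_bigr => k _.
by rewrite fcos_ordS fsin_ordS; ring.
Qed.

Lemma sum_shift_bounds (c d : R) (x : 'I_n -> R) :
    (forall k, (0 < k < n)%N -> c <= cosn k <= d) -> \sum_j x j = 0 ->
  c * \sum_j x j ^+ 2 <= \sum_j x j * x (ordS j) <= d * \sum_j x j ^+ 2.
Proof.
move=> cd x0.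
have nR : 0 < n%:R :> R by rewrite ltr0n.
have fc0 : fcos x 0 = 0.
  by rewrite -[RHS]x0; apply: eq_bigr => j _; rewrite cosn0 mulr1.
have fs0 : fsin x 0 = 0.
  by apply: big1 => j _; rewrite /sinn mulr0 sin0 mulr0.
have sq : \sum_(k < n) (fcos x k ^+ 2 + fsin x k ^+ 2)
    = n%:R * \sum_j x j ^+ 2.
  under [in RHS]eq_bigr do rewrite expr2.
  by rewrite -parseval; apply: eq_bigr => k _; rewrite !expr2.
rewrite -(ler_pM2l nR (c * _)) -(ler_pM2l nR _ (d * _)) sum_shift.
rewrite 2![n%:R * (_ * _)]mulrCA -sq 2!mulr_sumr.
apply/andP; split; apply: ler_sum => k _;
  (* [cosn 0] = 1 need not lie between c and d, but its weight is zero. *)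
  (have [->|k0] := posnP k; first by rewrite fc0 fs0 expr0n/= addr0 !mulr0);
  have /cd/andP[ck kd] : (0 < k < n)%N by [rewrite k0 ltn_ord];
  by apply: ler_wpM2r => //; rewrite addr_ge0 ?sqr_ge0.
Qed.

Lemma sum_shift_attained k : (0 < k < n)%N -> exists x : 'I_n -> R,
  [/\ \sum_j x j = 0, \sum_j x j ^+ 2 = 1 & \sum_j x j * x (ordS j) = cosn k].
Proof.
move=> kn; pose y (j : 'I_n) := cosn (k * j).
have y0 : \sum_j y j = 0 by exact: (sum_cosn_sinn _ kn).1.
pose N := \sum_j y j ^+ 2.
have N0 : 0 < N.
  (* The entry of y at index 0 is 1. *)
  rewrite /N (bigD1 (Ordinal n0))//= /y muln0 cosn0 expr1n.
  by rewrite ltr_wpDr ?ltr01// sumr_ge0// => j _; exact: sqr_ge0.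
(* The second difference equation y_(j+2) + y_j = 2 cos(2 pi k / n) y_(j+1). *)
have yS : \sum_j y j * y (ordS j) = cosn k * N.
  suff: \sum_j y j * y (ordS j) + \sum_j y j * y (ordS j) = cosn k * N *+ 2.
    by lra.
  rewrite -{1}(sum_ordS (fun j => y j * y (ordS j))) -big_split/=.
  rewrite /N -(sum_ordS (fun j => y j ^+ 2)) mulr_sumr -sumrMnl.
  apply: eq_bigr => j _.
  rewrite /y [cosn (k * ordS (ordS j))]cosn_ordS cosnD cosn_ordS sinn_ordS.
  rewrite !(cosnD (k * j)) !(sinnD (k * j)).
  have h : cosn k ^+ 2 = 1 - sinn k ^+ 2 by rewrite -(cosn2Dsinn2 k) addrK.
  by ring: h.
pose c := (Num.sqrt N)^-1.
have c2 : c ^+ 2 = N^-1 by rewrite /c exprVn sqr_sqrtr// ltW.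
exists (fun j => c * y j); split.
- by rewrite -mulr_sumr y0 mulr0.
- under eq_bigr do rewrite exprMn.
  by rewrite -mulr_sumr c2 mulVf// gt_eqF.
- under eq_bigr do rewrite mulrACA -expr2.
  by rewrite -mulr_sumr c2 yS mulrC mulfK// gt_eqF.
Qed.

(** * Extreme values of the cosines *)

Lemma cosn_sub k : (k <= n)%N -> cosn (n - k) = cosn k.
Proof.
move=> kn; have := cosnD (n - k) k; have := sinnD (n - k) k.
rewrite subnK// cosnn sinnn => hs hc.
rewrite -[LHS]mulr1 -(cosn2Dsinn2 k).
by rewrite -[RHS]mulr1 hc -[RHS]addr0 -(mulr0 (sinn k)) hs; ring.
Qed.

Lemma cosn_half_bounds k : (0 < k < n)%N -> cosn n./2 <= cosn k <= cosn 1.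
Proof.
(* Reflecting k to n - k brings the angle into [0, pi], where the cosine is decreasing. *)
wlog kh : k / (k <= n./2)%N.
  move=> H kn; have [kh|kh] := leqP k n./2; first exact: H.
  by rewrite -(cosn_sub k); [apply: H; lia | lia].
have in_pi m : (m <= n./2)%N -> 2 * pi / n%:R * m%:R \in `[0, pi : R].
  move=> mh; rewrite in_itv/=.
  have -> : 2 * pi / n%:R * m%:R = pi * ((2 * m)%:R / n%:R) :> R.
    by rewrite natrM; ring.
  rewrite mulr_ge0 ?pi_ge0 ?divr_ge0//=.
  by rewrite ger_pMr ?pi_gt0// ler_pdivrMr ?ltr0n// mul1r ler_nat; lia.
move=> kn; have le_cosn a b : (a <= b <= n./2)%N -> cosn b <= cosn a.
  move=> ab; rewrite /cosn leNgt ltr_cos ?in_pi//; last by lia.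
    rewrite -leNgt ler_wpM2l// ?ler_nat; last by lia.
    by rewrite divr_ge0// mulr_ge0// pi_ge0.
  by lia.
by rewrite !le_cosn//; lia.
Qed.

Lemma cosn_half : cosn n./2 =
  if odd n then cos (pi * ((n%:R - 1) / n%:R)) else -1.
Proof.
rewrite /cosn; have := odd_double_half n; case: ifP => _ /= h.
  rewrite -[in (n%:R - 1)]h natrD addrC addKr -muln2 natrM.
  by congr cos; ring.
rewrite -cospi; congr cos.
by rewrite -[in n%:R]h add0n -mul2n natrM; field; rewrite pnatr_eq0; lia.
Qed.

End roots_of_unity.

(** * The Laplacian form of a dicycle *)

Lemma quad_form_laplacian (R : realType) n (G : digraph n) (x : 'cV[R]_n) :
  quad_form (laplacian R G) x
  = \sum_i \sum_j (G i j)%:R * (x i 0 ^+ 2 - x i 0 * x j 0).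
Proof.
rewrite quad_formE; under eq_bigr do rewrite mulr_suml.
rewrite exchange_big; apply: eq_bigr => i _ /=.
under [RHS]eq_bigr do rewrite mulrBr.
rewrite sumrB -mulr_suml -natr_sum.
have -> : (\sum_j G i j)%N = out_degree G i.
  rewrite /out_degree -sum1_card [RHS]big_mkcond.
  by apply: eq_bigr => j _; rewrite inE; case: (G i j).
(* Without loops, the diagonal entry of the Laplacian is exactly the out-degree. *)
rewrite (bigD1 i)//= [in RHS](bigD1 i)//= !mxE eqxx edge_irr.
rewrite mulr1n opprD addrA; congr (_ + _); first by ring.
rewrite -sumrN; apply: eq_bigr => j ji.
by rewrite !mxE eq_sym (negPf ji) mulr0n; ring.
Qed.

Lemma quad_form_dicycle (R : realType) n (G : digraph n) (s : {perm 'I_n})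
    (x : 'cV[R]_n) : (forall i j, G (s i) (s j) = (j == ordS i)) ->
  quad_form (laplacian R G) x
  = \sum_i x (s i) 0 ^+ 2 - \sum_i x (s i) 0 * x (s (ordS i)) 0.
Proof.
move=> Gs; rewrite quad_form_laplacian -sumrB (reindex_perm s)/=.
apply: eq_bigr => i _; rewrite (reindex_perm s) (bigD1 (ordS i))//= big1.
  by rewrite Gs eqxx mul1r addr0.
by move=> j /negPf ji; rewrite Gs ji mul0r.
Qed.

Lemma restricted_sphere_perm (R : realType) n (s : {perm 'I_n}) (x : 'cV[R]_n) :
  restricted_sphere R n x <->
  \sum_i x (s i) 0 = 0 /\ \sum_i x (s i) 0 ^+ 2 = 1.
Proof.
rewrite restricted_sphereE.
by rewrite (reindex_perm s) [X in _ /\ X = _](reindex_perm s).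
Qed.

Theorem corollary3p1 (R : realType) (n : nat) (hn : (2 <= n)%N)
    (G : digraph n) (hG : dicycle G) :
  laplacian_spread R G =
    if odd n then cos (2 * pi / n%:R) - cos (pi * ((n%:R - 1) / n%:R))
    else 1 + cos (2 * pi / n%:R).
Proof.
have [s Gs] := hG; have n0 : (0 < n)%N by exact: ltnW.
(* The shift sum enters with a minus sign, so the greatest cosine bounds the form from below. *)
have bounds x : restricted_sphere R n x ->
    1 - cosn n 1 <= quad_form (laplacian R G) x <= 1 - cosn n n./2.
  move=> /(restricted_sphere_perm _ _ s)[x0 x1].
  have := sum_shift_bounds n n0 _ _ _ (@cosn_half_bounds R n n0) x0.
  rewrite (quad_form_dicycle _ _ _ s)// x1 !mulr1 => /andP[h1 h2].
  by rewrite !lerD2l !lerN2 h1 h2.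
have attained k : (0 < k < n)%N -> exists2 x, restricted_sphere R n x &
    quad_form (laplacian R G) x = 1 - cosn n k.
  move=> /(sum_shift_attained n n0 (R := R))[y [y0 y1 yS]].
  (* The extremal vector is carried back to the original labels. *)
  pose x : 'cV[R]_n := \col_i y ((s^-1)%g i).
  have xE i : x (s i) 0 = y i by rewrite mxE permK.
  exists x; first apply/(restricted_sphere_perm _ _ s).
    by split; [rewrite -[RHS]y0|rewrite -[RHS]y1]; apply: eq_bigr => i _;
      rewrite xE.
  rewrite (quad_form_dicycle _ _ _ s)// -yS -y1.
  by congr (_ - _); apply: eq_bigr => i _; rewrite !xE.
have aE : alpha R G = 1 - cosn n 1.
  have [[x /bounds/andP[lx _] xE] lb] := alpha_min R G hn.
  have [y /lb ay yE] := attained 1%N hn.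
  by apply/eqP; rewrite eq_le -{1}yE ay -xE.
have bE : beta R G = 1 - cosn n n./2.
  have [[x /bounds/andP[_ ux] xE] ub] := beta_max R G hn.
  have [|y /ub yb yE] := attained n./2; first by lia.
  by apply/eqP; rewrite eq_le -{2}yE yb -xE ux.
rewrite /laplacian_spread aE bE cosn_half// /cosn mulr1.
by case: ifP => _; ring.
Qed.
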